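(* Let $n\ge 2$ and let $G=K_{2,n}$ be the complete bipartite graph with parts of sizes $2$ and $n$. Then the ideal $I_G$ is generated by its elements of degrees $2$ and $4$.
   Context: Graphs are finite and simple. For a graph $G$ with vertex set $[N]=\{1,\dots,N\}$, edge set $E(G)$ and set of isolated vertices $Iso(G)$, the ideal of the binary graph model (graph ideal) $I_G$ is the kernel of the $\mathbb{C}$-algebra homomorphism $$\phi_G:\mathbb{C}[p_{i_1\cdots i_N}\mid i_j\in\{0,1\}]\to \mathbb{C}[t^{(j,k)}_{a,b},\,t^{(l)}_{a}\mid \{j,k\}\in E(G),\ l\in Iso(G),\ a,b\in\{0,1\}],$$ $$p_{i_1\cdots i_N}\mapsto \prod_{\{j,k\}\in E(G)}t^{(j,k)}_{i_j,i_k}\prod_{l\in Iso(G)}t^{(l)}_{i_l}.$$ It is a toric ideal, homogeneous in the standard grading. *)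

(* Defs.v *)
From HB Require Import structures.
From mathcomp Require Import all_boot all_order all_algebra.
From mathcomp Require Import reals.
From mathcomp.real_closed Require Import complex.
From mathcomp.multinomials Require Import mpoly.

Set Implicit Arguments.
Unset Strict Implicit.
Unset Printing Implicit Defensive.

Import GRing.Theory.

Local Open Scope ring_scope.

Record sgraph (N : nat) := SGraph {
  adj :> rel 'I_N;
  adj_sym : ssrbool.symmetric adj;
  adj_irr : irreflexive adj
}.

Section GraphIdeal.

Variables (K : comNzRingType) (N : nat) (G : sgraph N).

(* The edge {j, k} is represented by its unique ordered pair with j < k. *)
Definition is_edge (e : 'I_N * 'I_N) : bool := (e.1 < e.2)%N && G e.1 e.2.

Definition edge := {e : 'I_N * 'I_N | is_edge e}.

Definition is_isolated (l : 'I_N) : bool := [forall k, ~~ G l k].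

Definition isolated := {l : 'I_N | is_isolated l}.

Definition state := {ffun 'I_N -> bool}.

Definition param := (edge * (bool * bool) + isolated * bool)%type.

(* mpoly indexes its variables by ordinals: the variable p_i (resp. t_x) is
   the one of index enum_rank i (resp. enum_rank x). *)
Definition pring := {mpoly K[#|{: state}|]}.
Definition tring := {mpoly K[#|{: param}|]}.

Definition tvar (x : param) : tring := 'X_(enum_rank x).

Definition phi_var (i : state) : tring :=
  (\prod_(e : edge) tvar (inl (e, (i (val e).1, i (val e).2)))) *
  (\prod_(l : isolated) tvar (inr (l, i (val l)))).

Definition phi (p : pring) : tring :=
  p \mPo [tuple phi_var (enum_val v) | v < #|{: state}|].

Definition graph_ideal (p : pring) : Prop := phi p = 0.

End GraphIdeal.

Definition ideal_gen (A : comNzRingType) (S : A -> Prop) (p : A) : Prop :=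
  exists s : seq (A * A),
    (forall x, x \in s -> S x.2) /\ p = \sum_(x <- s) x.1 * x.2.

Section CompleteBipartite.

Variables m n : nat.

Definition Kadj : rel 'I_(m + n) := fun u v => (u < m)%N != (v < m)%N.

Lemma Kadj_sym : ssrbool.symmetric Kadj.
Proof. by move=> u v; rewrite /Kadj eq_sym. Qed.

Lemma Kadj_irr : irreflexive Kadj.
Proof. by move=> u; rewrite /Kadj eqxx. Qed.

(* The parts are {0, ..., m-1} and {m, ..., m+n-1}. *)
Definition complete_bipartite : sgraph (m + n) := SGraph Kadj_sym Kadj_irr.

End CompleteBipartite.

(* Main.v *)
Require Import Defs.
From mathcomp Require Import all_boot all_order all_algebra.
From mathcomp Require Import reals zify.
From mathcomp.real_closed Require Import complex.
From mathcomp.multinomials Require Import mpoly.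

(** Monomials in the variables p_i are multisets of states. The kernel of a map
    sending monomials to monomials is spanned by the differences of two monomials
    with the same image ([kernel_binomials]), and two multisets of states have
    the same image exactly when every edge {u, v} has the same table of joint
    values (i_u, i_v) in both ([expo_margins]). If any two multisets with equal
    margins are joined by a chain of replacements of 2 or of 4 states by as many
    states with the same margins, then each such difference telescopes into
    multiples of binomials of degree 2 or 4 of the ideal ([markov_basis]).

    It remains to build such chains for K_{2,n} ([same_margins_connected]). Let
    a, b be the values of a state at the two hubs; call the states with given
    (a, b) a class, and let M_ab(j, c) be the number of states of class ab taking
    the value c at the leaf j. Exchanging the values of two states of one class
    at a leaf preserves the margins, and these quadratic moves join any two
    multisets with the same numbers M_ab(j, c) ([same_cells_connected]).

    If s and t have equal margins, then M_ab(j, c)(t) - M_ab(j, c)(s) equals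
    d(j, c) when a = b and - d(j, c) when a <> b, and d(j, 0) + d(j, 1) = d is
    the same for all leaves j, being the difference of the sizes of class 00.
    Exchanging s and t, assume that d >= 0. The sum of all |d(j, c)| is then
    decreased as follows, until it vanishes.
    - If d > 0, every leaf j has a value u_j with d(j, u_j) > 0. Hence, up to
      moves within the classes, s contains the states 01u and 10u, and the
      quadratic move 01u + 10u -> 00u + 11u lowers each d(j, u_j) by 1
      ([raise_class]).
    - If d = 0 and some d(j, c) > 0, then d(j, 1 - c) < 0, so s has a state of
      each class whose value at j is 1 - c for 00 and 11, and c for 01 and 10;
      changing these four values is a quartic move which brings both d(j, c) and
      d(j, 1 - c) closer to 0 ([flip_leaf]). *)

Set Implicit Arguments.
Unset Strict Implicit.
Unset Printing Implicit Defensive.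

Import GRing.Theory.

Local Open Scope ring_scope.

(** * Generated ideals *)

Section IdealGen.

Variables (A : comNzRingType) (S T : A -> Prop).

Lemma ideal_gen_mem x : S x -> ideal_gen S x.
Proof.
move=> Sx; exists [:: (1, x)]; split; last by rewrite big_seq1 mul1r.
by move=> y; rewrite inE => /eqP->.
Qed.

Lemma ideal_gen0 : ideal_gen S 0.
Proof. by exists [::]; split=> //; rewrite big_nil. Qed.

Lemma ideal_genD x y : ideal_gen S x -> ideal_gen S y -> ideal_gen S (x + y).
Proof.
move=> [s [sS ->]] [t [tS ->]]; exists (s ++ t); split; last by rewrite big_cat.
by move=> z; rewrite mem_cat => /orP[/sS|/tS].
Qed.

Lemma ideal_genMl a x : ideal_gen S x -> ideal_gen S (a * x).
Proof.
move=> [s [sS ->]]; exists [seq (a * z.1, z.2) | z <- s]; split.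
  by move=> _ /mapP[z /sS Sz ->].
by rewrite big_map mulr_sumr; apply: eq_bigr => z _; rewrite mulrA.
Qed.

Lemma ideal_gen_sub x : (forall y, S y -> T y) -> ideal_gen S x -> ideal_gen T x.
Proof. by move=> ST [s [sS ->]]; exists s; split=> // y /sS/ST. Qed.

End IdealGen.

(** * Kernels of monomial maps *)

(** Replacing every exponent m by a fixed representative r m of its fiber
    under A sends p to a polynomial whose coefficients are sums of coefficients
    of p over the fibers of A. Those sums are the coefficients of f p, so they
    vanish, and p equals the difference between p and its image. *)
Lemma kernel_binomials (K : comNzRingType) (n k : nat)
    (f : {linear {mpoly K[n]} -> {mpoly K[k]}})
    (A : 'X_{1..n} -> 'X_{1..k}) (p : {mpoly K[n]}) :
  (forall m, f 'X_[m] = 'X_[A m]) -> f p = 0 ->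
  exists r : 'X_{1..n} -> 'X_{1..n},
    (forall m, m \in msupp p -> A (r m) = A m) /\
    p = \sum_(m <- msupp p) p@_m *: ('X_[m] - 'X_[r m]).
Proof.
move=> fX fp0.
pose rep d := nth 0%MM (msupp p) (find (fun m => A m == d) (msupp p)).
exists (rep \o A); split=> [m mp|].
  by apply/eqP/(nth_find 0%MM (a := fun m' => A m' == A m))/hasP; exists m.
under eq_bigr do rewrite scalerBr.
rewrite sumrB -mpolyE [X in _ - X](_ : _ = 0) ?subr0 //.
(* Both sides group the same sum by fibers; each fiber sum is a coefficient of f p. *)
pose D := undup [seq A m | m <- msupp p].
transitivity (\sum_(d <- D) (f p)@_d *: ('X_[rep d] : {mpoly K[n]})); last first.
  by rewrite fp0 big1 // => d _; rewrite mcoeff0 scale0r.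
have fpE d : (f p)@_d = \sum_(m <- msupp p) p@_m * (A m == d)%:R.
  rewrite {1}[p]mpolyE !raddf_sum /=; apply: eq_bigr => m _.
  by rewrite linearZ /= mcoeffZ fX mcoeffX.
under [RHS]eq_bigr do rewrite fpE scaler_suml.
rewrite exchange_big /= [LHS]big_seq [RHS]big_seq; apply: eq_bigr => m mp.
rewrite (bigD1_seq (A m)) ?undup_uniq ?mem_undup ?map_f //= eqxx mulr1.
by rewrite big1 ?addr0 // => d; rewrite eq_sym => /negPf->; rewrite mulr0 scale0r.
Qed.

(** * Margins and moves *)

Local Open Scope nat_scope.

Section Moves.

Variables (N : nat) (G : sgraph N).

Definition margin (s : seq (state N)) u v (a c : bool) :=
  count (fun i : state N => (i u == a) && (i v == c)) s.

(** Multisets of states with the same margins form a fiber of the model; when no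
    vertex is isolated, these are the monomials with the same image under phi. *)
Definition same_margins (s t : seq (state N)) :=
  forall u v (a c : bool), G u v ->
    margin s u v a c = margin t u v a c.

Lemma marginC s u v a c : margin s u v a c = margin s v u c a.
Proof. by apply: eq_count => i; rewrite andbC. Qed.

(** Connectivity of fibers by moves whose size lies in D, on multisets of states
    presented as sequences. A move replaces a sub-multiset s by a t with the same
    margins and leaves the remaining states r in place. *)
Inductive connected (D : pred nat) : seq (state N) -> seq (state N) -> Prop :=
| ConnPerm s t : perm_eq s t -> connected D s t
| ConnMove s t r : D (size s) -> size t = size s -> same_margins s t ->
    connected D (s ++ r) (t ++ r)
| ConnTrans s t w : connected D s t -> connected D t w -> connected D s w.

Lemma same_margins_sym s t : same_margins s t -> same_margins t s.
Proof. by move=> st u v a c uv; rewrite st. Qed.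

Lemma same_margins_trans s t w :
  same_margins s t -> same_margins t w -> same_margins s w.
Proof. by move=> st tw u v a c uv; rewrite st // tw. Qed.

Lemma connected_sym D s t : connected D s t -> connected D t s.
Proof.
elim=> [{}s {}t st|{}s {}t r Ds sz st|{}s {}t w _ ts _ wt].
- by apply: ConnPerm; rewrite perm_sym.
- by apply: ConnMove; rewrite ?sz //; apply: same_margins_sym.
- exact: ConnTrans wt ts.
Qed.

Lemma connected_cat D s t r : connected D s t -> connected D (s ++ r) (t ++ r).
Proof.
elim=> [{}s {}t st|{}s {}t r' Ds sz st|{}s {}t w _ ts _ wt].
- by apply: ConnPerm; rewrite perm_cat2r.
- by rewrite -!catA; apply: ConnMove.
- exact: ConnTrans ts wt.
Qed.

Lemma connected_cons D x s t : connected D s t -> connected D (x :: s) (x :: t).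
Proof.
move=> /(connected_cat [:: x]) st.
apply: ConnTrans (ConnTrans _ st) _; apply: ConnPerm.
  by rewrite -cat1s perm_catC.
by rewrite perm_catC.
Qed.

Lemma connected_margins D s t : connected D s t -> same_margins s t.
Proof.
elim=> [{}s {}t /permP st u v a c _|{}s {}t r' Ds sz st|{}s {}t w _ ts _ wt].
- exact: st.
- by move=> u v a c uv; rewrite /margin !count_cat; congr addn; apply: st.
- exact: same_margins_trans ts wt.
Qed.

End Moves.

(** * Markov bases generate graph ideals *)

Local Open Scope ring_scope.

Section MarkovBasis.

Variables (K : comNzRingType) (N : nat) (G : sgraph N).
Hypothesis no_isolated : forall l, ~~ is_isolated G l.

Notation state := (state N).
Notation param := (param G).

Definition mon (s : seq state) : pring K N := \prod_(i <- s) 'X_(enum_rank i).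

Lemma mon_homog s : mon s \is (size s).-homog.
Proof.
elim: s => [|i s IH]; first by rewrite /mon big_nil dhomog1.
by rewrite /mon big_cons (dhomogM (d := 1)) ?IH // dhomogX /= mdeg1.
Qed.

Definition states_of (m : 'X_{1..#|{: state}|}) : seq state :=
  flatten [seq nseq (m v) (enum_val v) | v <- enum 'I_#|{: state}|].

Lemma mon_states_of m : mon (states_of m) = 'X_[m].
Proof.
rewrite /mon big_flatten big_map /= mpolyXE_id big_enum /=.
by apply: eq_bigr => v _; rewrite big_nseq enum_valK iter_mulr_1.
Qed.

(** The exponent of the monomial phi_var. *)
Definition expo1 (i : state) : 'X_{1..#|{: param}|} :=
  (\sum_(e : edge G)
     U_(enum_rank (inl (e, (i (val e).1, i (val e).2)) : param)) +
   \sum_(l : isolated G) U_(enum_rank (inr (l, i (val l)) : param)))%MM.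

Definition expo (s : seq state) := (\sum_(i <- s) expo1 i)%MM.

Lemma phi_mon s : phi G (mon s) = 'X_[expo s].
Proof.
rewrite /phi /mon rmorph_prod /expo -mprodXE; apply: eq_bigr => i _.
rewrite /= comp_mpolyXU -tnth_nth tnth_mktuple enum_rankK /phi_var /expo1 mpolyXD.
by congr (_ * _); rewrite -mprodXE.
Qed.

Lemma expo_edge s (e : edge G) a c :
  expo s (enum_rank (inl (e, (a, c)) : param)) =
  margin s (val e).1 (val e).2 a c.
Proof.
rewrite /margin /expo mnm_sumE -sum1_count [RHS]big_mkcond; apply: eq_bigr => i _.
rewrite /expo1 mnmDE !mnm_sumE [X in (_ + X)%N]big1 ?addn0 => [|l _]; last first.
  by rewrite mnm1E (inj_eq enum_rank_inj).
rewrite (bigD1 e) //= big1 ?addn0 => [|e' ne]; last first.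
  rewrite mnm1E (inj_eq enum_rank_inj) -[_ == _]/((_ == _) && (_ == _)).
  by rewrite (negPf ne).
rewrite mnm1E (inj_eq enum_rank_inj) -[_ == _]/((_ == _) && ((_ == _) && (_ == _))).
by rewrite eqxx /=; case: (_ && _).
Qed.

(** The parameters of an edge occur in the image of a monomial as many times as
    the margins say; without isolated vertices there are no other parameters. *)
Lemma expo_margins s t : expo s = expo t <-> same_margins G s t.
Proof.
split=> [st u v a c uv|st].
  have [uv'|vu|/val_inj e] := ltngtP u v; last by rewrite e adj_irr in uv.
    have e : is_edge G (u, v) by rewrite /is_edge uv' uv.
    by rewrite -!(expo_edge _ (Sub (u, v) e)) st.
  have e : is_edge G (v, u) by rewrite /is_edge vu adj_sym uv.
  by rewrite ![margin _ u v _ _]marginC -!(expo_edge _ (Sub (v, u) e)) st.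
apply/mnmP=> x; rewrite -(enum_valK x); case: (enum_val x) => [[e [a c]]|[l a]].
  by rewrite !expo_edge; apply: st; case/andP: (valP e).
by have := no_isolated (val l); rewrite (valP l).
Qed.

Lemma graph_ideal_mon s t :
  graph_ideal G (mon s - mon t) <-> same_margins G s t.
Proof.
rewrite -expo_margins /graph_ideal {1}/phi rmorphB /= -!/(phi G _) !phi_mon.
split=> [/(congr1 (mcoeff (expo s)))|->]; last by rewrite subrr.
rewrite mcoeffB !mcoeffX eqxx mcoeff0; case: (_ =P _) => // _.
by rewrite subr0 => /eqP; rewrite oner_eq0.
Qed.

Variable D : pred nat.

Let gens (q : pring K N) :=
  graph_ideal G q /\ exists2 d, D d & q \is d.-homog.

(** A move gives a homogeneous binomial of the graph ideal times a monomial, and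
    a path of moves gives a telescoping sum of such products. *)
Lemma connected_binomial s t :
  connected G D s t -> ideal_gen gens (mon s - mon t).
Proof.
elim=> [{}s {}t st|{}s {}t r Ds sz st|{}s {}t w _ ts _ wt].
- by rewrite /mon (perm_big _ st) subrr; apply: ideal_gen0.
- rewrite /mon !big_cat /= -mulrBl mulrC; apply/ideal_genMl/ideal_gen_mem.
  split; first exact/graph_ideal_mon.
  by exists (size s) => //; apply: rpredB; [|rewrite -sz]; apply: mon_homog.
- by rewrite -(subrK (mon t) (mon s)) -addrA; exact: ideal_genD.
Qed.

(** The half of the Diaconis-Sturmfels theorem that turns connectivity of all
    fibers into generation of the toric ideal. *)
Theorem markov_basis (p : pring K N) :
  (forall s t, same_margins G s t -> connected G D s t) ->
  graph_ideal G p <-> ideal_gen gens p.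
Proof.
move=> conn; split=> [p0|[s [sS ->]]]; last first.
  rewrite /graph_ideal /phi rmorph_sum big_seq big1 //= => x /sS[x0 _].
  by rewrite rmorphM /= -/(phi G x.2) x0 mulr0.
have phiX m : phi G ('X_[m] : pring K N) = 'X_[expo (states_of m)].
  by rewrite -mon_states_of phi_mon.
pose f := comp_mpoly [tuple phi_var K G (enum_val v) | v < #|{: state}|].
have [r [rA ->]] := @kernel_binomials K _ _ f (expo \o states_of) p phiX p0.
rewrite big_seq; apply: big_ind => [||m mp]; first exact: ideal_gen0.
  exact: ideal_genD.
rewrite -mul_mpolyC; apply: ideal_genMl.
rewrite -!mon_states_of; apply/connected_binomial/conn/expo_margins.
exact/esym/rA.
Qed.

End MarkovBasis.

(** * States of K_{2,n} and their cells *)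

Local Open Scope nat_scope.

Section CompleteBipartite2.

Variable n : nat.
Hypothesis n_gt0 : 0 < n.

Notation state := (state (2 + n)).
Notation K2n := (complete_bipartite 2 n).
Notation connected := (connected K2n (pred2 2 4)).

Definition hubA : 'I_(2 + n) := lshift n ord0.
Definition hubB : 'I_(2 + n) := lshift n ord_max.
Definition leaf (j : 'I_n) : 'I_(2 + n) := rshift 2 j.

Definition cell (a b : bool) j (c : bool) (i : state) :=
  [&& i hubA == a, i hubB == b & i (leaf j) == c].

(** The refinement of the margins by the values at both hubs; together these
    numbers determine a multiset of states up to moves within the classes. *)
Definition cell_count s a b j c := count (cell a b j c) s.

Definition same_cells s t :=
  forall a b j c, cell_count s a b j c = cell_count t a b j c.

Definition build a b (u : 'I_n -> bool) : state :=
  [ffun v => match split v with inl k => if k == ord0 then a else b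
                              | inr j => u j end].

Definition set_leaf (i : state) j c : state :=
  build (i hubA) (i hubB) (fun k => if k == j then c else i (leaf k)).

Lemma build_hubA a b u : build a b u hubA = a.
Proof. by rewrite ffunE (unsplitK (inl ord0 : 'I_2 + 'I_n)%type). Qed.

Lemma build_hubB a b u : build a b u hubB = b.
Proof. by rewrite ffunE (unsplitK (inl ord_max : 'I_2 + 'I_n)%type). Qed.

Lemma build_leaf a b u j : build a b u (leaf j) = u j.
Proof. by rewrite ffunE (unsplitK (inr j : 'I_2 + 'I_n)%type). Qed.

Definition buildE := (build_hubA, build_hubB, build_leaf).

Lemma vertexP (v : 'I_(2 + n)) : [\/ v = hubA, v = hubB | exists j, v = leaf j].
Proof.
rewrite -(splitK v); case: (split v) => [k|j] /=; last by constructor 3; exists j.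
case: k => [[|[|k]] lk] //; [constructor 1|constructor 2]; exact: val_inj.
Qed.

Lemma state_eq (x y : state) : x hubA = y hubA -> x hubB = y hubB ->
  (forall j, x (leaf j) = y (leaf j)) -> x = y.
Proof.
by move=> hA hB hl; apply/ffunP=> v; case: (vertexP v) => [->|->|[j ->]].
Qed.

Lemma K2nP (P : 'I_(2 + n) -> 'I_(2 + n) -> Prop) :
  (forall u v, P u v -> P v u) ->
  (forall j, P hubA (leaf j)) -> (forall j, P hubB (leaf j)) ->
  forall u v, K2n u v -> P u v.
Proof.
move=> Psym PA PB u v.
by case: (vertexP u) => [->|->|[j ->]]; case: (vertexP v) => [->|->|[k ->]] // _;
  apply: Psym.
Qed.

Lemma margin_hubA s a j c :
  margin s hubA (leaf j) a c =
  cell_count s a false j c + cell_count s a true j c.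
Proof.
rewrite /margin /cell_count; elim: s => //= i s ->; rewrite /cell.
by case: (i hubB); case: (i hubA == a); case: (i (leaf j) == c) => /=; lia.
Qed.

Lemma margin_hubB s b j c :
  margin s hubB (leaf j) b c =
  cell_count s false b j c + cell_count s true b j c.
Proof.
rewrite /margin /cell_count; elim: s => //= i s ->; rewrite /cell.
by case: (i hubA); case: (i hubB == b); case: (i (leaf j) == c) => /=; lia.
Qed.

Lemma same_marginsP s t : same_margins K2n s t <->
  forall j c,
    (forall a, cell_count s a false j c + cell_count s a true j c =
               cell_count t a false j c + cell_count t a true j c) /\
    (forall b, cell_count s false b j c + cell_count s true b j c =
               cell_count t false b j c + cell_count t true b j c).
Proof.
split=> [st j c|st u v a c uv].
  by split=> a; rewrite -?margin_hubA -?margin_hubB; apply: st.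
move: u v uv a c.
apply: (K2nP (P := fun u v => forall a c, margin s u v a c = margin t u v a c)).
- by move=> u v uv a c; rewrite !(marginC _ v) uv.
- by move=> j a c; rewrite !margin_hubA; have [-> _] := st j c.
- by move=> j a c; rewrite !margin_hubB; have [_ ->] := st j c.
Qed.

Lemma cell_count_cons x s a b j c :
  cell_count (x :: s) a b j c = cell a b j c x + cell_count s a b j c.
Proof. by []. Qed.

Lemma cell_count_perm s t : perm_eq s t -> same_cells s t.
Proof. by move=> /permP st a b j c; apply: st. Qed.

Lemma same_cells_margins s t : same_cells s t -> same_margins K2n s t.
Proof. by move=> st; apply/same_marginsP=> j c; split=> a; rewrite !st. Qed.

Lemma cell_self (x : state) j : cell (x hubA) (x hubB) j (x (leaf j)) x.
Proof. by rewrite /cell !eqxx. Qed.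

Lemma extract_cell s a b j c : 0 < cell_count s a b j c ->
  exists (x : state) (r : seq state),
    [/\ perm_eq s (x :: r), x hubA = a, x hubB = b, x (leaf j) = c &
      forall a' b' k d, (a', b') != (a, b) ->
        cell_count r a' b' k d = cell_count s a' b' k d].
Proof.
rewrite {1}/cell_count -has_count => /hasP[x xs /and3P[/eqP xA /eqP xB /eqP xj]].
have p := perm_to_rem xs; exists x, (rem x s); split=> // a' b' k d ne.
rewrite (cell_count_perm p) cell_count_cons /cell xA xB andbA.
by rewrite -[X in X && _]/((a, b) == (a', b')) eq_sym (negPf ne).
Qed.

(** * Quadratic moves within a class *)

Lemma swap_same_cells (y z : state) j r : y hubA = z hubA -> y hubB = z hubB ->
  same_cells [:: y, z & r]
    [:: set_leaf y j (z (leaf j)), set_leaf z j (y (leaf j)) & r].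
Proof.
move=> eA eB a b k c; rewrite !cell_count_cons /cell /set_leaf !buildE eA eB.
by case: (k =P j) => [->|_] //; lia.
Qed.

(** The state y is turned into x one leaf at a time: at a leaf where they differ,
    some z of the same class in r has the value of x, and the values of y and z
    are exchanged there. At the other leaves r offers the same values as before. *)
Lemma expose_from (x y : state) r : x hubA = y hubA -> x hubB = y hubB ->
  (forall j, x (leaf j) = y (leaf j) \/
             0 < cell_count r (x hubA) (x hubB) j (x (leaf j))) ->
  exists r', connected (y :: r) (x :: r') /\ same_cells (y :: r) (x :: r').
Proof.
have [m] := ubnP #|[pred j | x (leaf j) != y (leaf j)]|.
elim: m y r => // m IH y r lt_m eA eB ex.
have [j xyj|xy] := pickP [pred j | x (leaf j) != y (leaf j)]; last first.
  have -> : y = x.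
    by apply: state_eq => // j; apply/esym/eqP/negbFE; apply: xy.
  by exists r; split=> //; apply: ConnPerm.
have [/eqP|/extract_cell[z [r1 [pr zA zB zj _]]]] := ex j; first by rewrite (negPf xyj).
set y' := set_leaf y j (z (leaf j)); set z' := set_leaf z j (y (leaf j)).
have yz : same_cells [:: y, z & r1] [:: y', z' & r1].
  by apply: swap_same_cells; rewrite -?eA -?eB.
have [||||r' [cr er]] := IH y' (z' :: r1).
- rewrite -ltnS; apply: leq_trans lt_m; rewrite ltnS.
  apply/proper_card/properP; split.
    apply/subsetP=> k; rewrite !inE /y' /set_leaf !buildE.
    by case: (k =P j) => // ->; rewrite zj eqxx.
  by exists j; rewrite // !inE /y' /set_leaf !buildE eqxx zj eqxx.
- by rewrite buildE.
- by rewrite buildE.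
- move=> k; rewrite /y' /set_leaf !buildE.
  case: (k =P j) => [->|/eqP kj]; first by left.
  case: (ex k) => [|h]; [by left|right].
  rewrite (cell_count_perm pr) cell_count_cons in h; rewrite cell_count_cons.
  by apply: leq_trans h _; rewrite /cell /z' /set_leaf !buildE (negPf kj).
exists r'; split; last first.
  by move=> a b k c; rewrite -er -yz !cell_count_cons (cell_count_perm pr).
apply: ConnTrans cr; apply: ConnTrans (connected_cons y (ConnPerm _ _ pr)) _.
apply: (@ConnMove _ _ _ [:: y; z] [:: y'; z'] r1) => //.
by apply: same_cells_margins; apply: swap_same_cells; rewrite -?eA -?eB.
Qed.

(** Moves within a class can assemble any state whose value at each leaf is
    already taken by some state of that class. *)
Lemma expose (x : state) s :
  (forall j, 0 < cell_count s (x hubA) (x hubB) j (x (leaf j))) ->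
  exists r, connected s (x :: r) /\ same_cells s (x :: r).
Proof.
move=> ex; have [y [r [pr yA yB _ _]]] := extract_cell (ex (Ordinal n_gt0)).
have [//|//|j|r' [cr er]] := @expose_from x y r.
  have := ex j; rewrite (cell_count_perm pr) cell_count_cons /cell yA yB !eqxx /=.
  by rewrite eq_sym; case: eqP => [->|_] /=; [left|right].
exists r'; split; first exact: ConnTrans (ConnPerm _ _ pr) cr.
by move=> a b j c; rewrite (cell_count_perm pr).
Qed.

(** The head of s can be assembled in t by moves within its class, and is then
    cancelled from both sides. *)
Lemma same_cells_connected s t : same_cells s t -> connected s t.
Proof.
elim: s t => [|x s IH] t st.
  case: t st => [|y t] st; first exact: ConnPerm.
  have := st (y hubA) (y hubB) (Ordinal n_gt0) (y (leaf (Ordinal n_gt0))).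
  by rewrite cell_count_cons cell_self.
have [|r [cr er]] := @expose x t.
  by move=> j; rewrite -st cell_count_cons cell_self.
apply: ConnTrans (connected_sym cr); apply: connected_cons; apply: IH.
move=> a b j c; apply/eqP; rewrite -(eqn_add2l (cell a b j c x)) -!cell_count_cons.
by rewrite st er.
Qed.

(** * Moves between the classes *)

(** The absolute difference of the two counts in class 00; for equal margins the
    other three classes have the same one. *)
Definition cell_gap s t (p : 'I_n * bool) :=
  (cell_count s false false p.1 p.2 - cell_count t false false p.1 p.2) +
  (cell_count t false false p.1 p.2 - cell_count s false false p.1 p.2).

Definition cell_dist s t := \sum_p cell_gap s t p.

Lemma cell_dist_lt s s' t p : (forall q, cell_gap s' t q <= cell_gap s t q) ->
  cell_gap s' t p < cell_gap s t p -> cell_dist s' t < cell_dist s t.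
Proof.
move=> le lt; rewrite /cell_dist (bigD1 p) //= [ltnRHS](bigD1 p) //=.
rewrite -addSn leq_add //.
exact: leq_sum.
Qed.

Lemma cell_dist_sym s t : cell_dist s t = cell_dist t s.
Proof. by apply: eq_bigr => p _; rewrite /cell_gap addnC. Qed.

(** The quadratic move 01u + 10u -> 00u + 11u. At each leaf j the value u_j is
    chosen so that s has fewer states than t in the cell (j, u_j) of class 00;
    by the margins it has more in the corresponding cells of 01 and 10, so that
    both states 01u and 10u can be assembled. *)
Lemma raise_class s t : same_margins K2n s t ->
  (forall j, cell_count s false false j false + cell_count s false false j true <
             cell_count t false false j false + cell_count t false false j true) ->
  exists s', connected s s' /\ cell_dist s' t < cell_dist s t.
Proof.
move=> /same_marginsP st lt.
pose u j := cell_count s false false j true < cell_count t false false j true.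
have ltu j : cell_count s false false j (u j) < cell_count t false false j (u j).
  have := lt j; rewrite /u.
  case: (boolP (cell_count s false false j true <
                cell_count t false false j true)); lia.
have [|r1 [cr1 er1]] := @expose (build false true u) s.
  by move=> j; rewrite !buildE; have := ltu j; have [/(_ false)] := st j (u j); lia.
have [|r2 [cr2 er2]] := @expose (build true false u) r1.
  move=> j; rewrite !buildE; have := ltu j; have [_ /(_ false)] := st j (u j).
  by have := er1 true false j (u j); rewrite cell_count_cons /cell !buildE /=; lia.
exists [:: build false false u, build true true u & r2]; split.
  apply: ConnTrans cr1 _; apply: ConnTrans (connected_cons _ cr2) _.
  apply: (@ConnMove _ _ _ [:: _; _] [:: _; _]) => //.
  apply/same_marginsP=> j c; split=> a; rewrite !cell_count_cons /cell !buildE;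
    by case: a; case: (u j == c).
have cE j c :
    cell_count [:: build false false u, build true true u & r2] false false j c =
    (u j == c) + cell_count s false false j c.
  rewrite er1 !cell_count_cons er2 !cell_count_cons /cell !buildE /=; lia.
apply: (@cell_dist_lt _ _ _ (Ordinal n_gt0, u (Ordinal n_gt0))) => [[j c]|];
  rewrite /cell_gap cE /=.
  by case: eqP => [<-|_]; have := ltu j; lia.
by rewrite eqxx; have := ltu (Ordinal n_gt0); lia.
Qed.

(** The quartic move, which changes the value at the leaf j of one state of each
    class. The margins force states with suitable values in the classes 01, 10
    and 11, and the alternating changes cancel in the margins. *)
Lemma flip_leaf s t j c : same_margins K2n s t ->
  cell_count s false false j c < cell_count t false false j c ->
  cell_count t false false j (~~ c) < cell_count s false false j (~~ c) ->
  exists s', connected s s' /\ cell_dist s' t < cell_dist s t.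
Proof.
move=> /same_marginsP st ltc ltNc.
have [s00 s01 s10 s11] : [/\ 0 < cell_count s false false j (~~ c),
    0 < cell_count s false true j c, 0 < cell_count s true false j c &
    0 < cell_count s true true j (~~ c)].
  have [/(_ false) mA /(_ false) mB] := st j c.
  have [/(_ false) mA' /(_ true) mB'] := st j (~~ c).
  by move: ltc ltNc mA mB mA' mB'; clear; move: (~~ c) => d; split; lia.
have [x [r1 [p1 xA xB xj e1]]] := extract_cell s00.
have [|y [r2 [p2 yA yB yj e2]]] := @extract_cell r1 false true j c.
  by rewrite e1.
have [|z [r3 [p3 zA zB zj e3]]] := @extract_cell r2 true false j c.
  by rewrite e2 // e1.
have [|w [r4 [p4 wA wB wj _]]] := @extract_cell r3 true true j (~~ c).
  by rewrite e3 // e2 // e1.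
have p : perm_eq s [:: x, y, z, w & r4].
  apply: perm_trans p1 _; rewrite perm_cons; apply: perm_trans p2 _.
  by rewrite perm_cons; apply: perm_trans p3 _; rewrite perm_cons.
exists [:: set_leaf x j c, set_leaf y j (~~ c), set_leaf z j (~~ c),
  set_leaf w j c & r4]; split.
  apply: ConnTrans (ConnPerm _ _ p) _.
  apply: (@ConnMove _ _ _ [:: _; _; _; _] [:: _; _; _; _]) => //.
  apply/same_marginsP=> k d; split=> a;
    rewrite !cell_count_cons /cell /set_leaf !buildE xA xB yA yB zA zB wA wB /=;
    case: (k =P j) => [->|_] //; rewrite xj yj zj wj;
    by case: a; case: c d {ltc ltNc s00 s01 s10 s11 xj yj zj wj e1 e2 e3} => -[].
have cE k d : cell_count [:: set_leaf x j c, set_leaf y j (~~ c), set_leaf z j (~~ c),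
    set_leaf w j c & r4] false false k d =
    if k == j then (if d == c then (cell_count s false false j d).+1
                    else (cell_count s false false j d).-1)
    else cell_count s false false k d.
  rewrite !(cell_count_perm p) !cell_count_cons /cell /set_leaf !buildE.
  rewrite xA xB yA yB zA zB wA wB /=; case: (k =P j) => [->|_] //; rewrite xj.
  by case: c d {ltc ltNc s00 s01 s10 s11 xj yj zj wj e1 e2 e3} => -[].
apply: (@cell_dist_lt _ _ _ (j, c)) => [[k d]|]; rewrite /cell_gap cE /= ?eqxx;
  last by move: ltc; clear; lia.
case: (k =P j) => [->|_] //; case: (d =P c) => [->|/eqP dc].
  by move: ltc; clear; lia.
have -> : d = ~~ c by case: (d) (c) dc => -[].
by move: ltNc; clear; lia.
Qed.

(** Induction on the distance of the class 00 counts. Once they agree, the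
    margins make all counts agree. *)
Theorem same_margins_connected s t : same_margins K2n s t -> connected s t.
Proof.
have [m] := ubnP (cell_dist s t); elim: m s t => // m IH s t lt_m st.
pose N00 r := count (fun i : state => ~~ i hubA && ~~ i hubB) r.
have N00E r j : N00 r =
    cell_count r false false j false + cell_count r false false j true.
  rewrite /N00 /cell_count; elim: r => //= i r ->; rewrite /cell.
  by case: (i hubA); case: (i hubB); case: (i (leaf j)) => /=; lia.
wlog leN : s t lt_m st / N00 s <= N00 t.
  move=> hw; case: (leqP (N00 s) (N00 t)) => [|/ltnW] le; first exact: hw.
  by apply/connected_sym/hw; rewrite 1?cell_dist_sym //; apply: same_margins_sym.
have step s' : connected s s' /\ cell_dist s' t < cell_dist s t -> connected s t.
  case=> ss' lt; apply: (ConnTrans ss'); apply: IH; first exact: leq_trans lt _.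
  exact: same_margins_trans (same_margins_sym (connected_margins ss')) st.
move: leN; rewrite leq_eqVlt => /orP[/eqP eqN|ltN]; last first.
  by have [|s' /step] := raise_class st _; first by move=> j; rewrite -!N00E.
(* With classes of equal size, an excess of t at one value of a leaf is a
   deficit at the other value. *)
have eqN' j : cell_count s false false j false + cell_count s false false j true =
              cell_count t false false j false + cell_count t false false j true.
  by rewrite -!N00E.
have [[j c] /= lt|le] := pickP [pred p : 'I_n * bool |
    cell_count s false false p.1 p.2 < cell_count t false false p.1 p.2].
  have [|s' /step//] := @flip_leaf s t j c st lt.
  by have := eqN' j; case: c lt => /=; lia.
apply: same_cells_connected => a b j c.
have e00 : cell_count s false false j c = cell_count t false false j c.
  have := le (j, true); have := le (j, false); have := eqN' j.
  by rewrite /=; case: c; lia.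
move/same_marginsP: st => /(_ j c)[mA mB].
move: e00 (mA false) (mA true) (mB false) (mB true); clear.
by case: a; case: b; lia.
Qed.

Lemma K2n_no_isolated l : ~~ is_isolated K2n l.
Proof.
apply/forallPn; case: (vertexP l) => [->|->|[j ->]].
- by exists (leaf (Ordinal n_gt0)); rewrite negbK.
- by exists (leaf (Ordinal n_gt0)); rewrite negbK.
- by exists hubA; rewrite negbK.
Qed.

End CompleteBipartite2.

(** * Generation in degrees 2 and 4 *)

Local Open Scope ring_scope.

Theorem theorem3p3 (R : realType) (n : nat) (hn : (2 <= n)%N)
    (p : pring R[i] (2 + n)) :
  graph_ideal (complete_bipartite 2 n) p <->
  ideal_gen (fun q : pring R[i] (2 + n) =>
    graph_ideal (complete_bipartite 2 n) q /\
    (q \is 2.-homog \/ q \is 4.-homog)) p.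
Proof.
have n_gt0 : (0 < n)%N by apply: leq_trans hn.
rewrite (markov_basis (K2n_no_isolated n_gt0) _ (same_margins_connected n_gt0)).
split; apply: ideal_gen_sub => q [q0].
  by case=> d /orP[]/eqP-> qd; split=> //; [left|right].
by case=> qd; split=> //; [exists 2|exists 4].
Qed.
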